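(* Let $k\ge 2$ be an integer. Then $1$ is an eigenvalue of the adjacency matrix of the Andrásfai graph $\mathrm{And}(k)$ if and only if $k\equiv 3 \pmod 4$.
   Context: For an integer $k\ge 1$ put $n=3k-1$. The Andrásfai graph $\mathrm{And}(k)$ is the Cayley graph $\mathrm{Cay}(\mathbb{Z}_n,S)$ of the additive group $\mathbb{Z}_n=\{0,1,\dots,n-1\}$ with connection set $S=\{x\in\mathbb{Z}_n : x\equiv 1 \bmod 3\}=\{1,4,7,\dots,3k-2\}$, where the congruence mod $3$ is for the representatives $0,1,\dots,n-1$. That is, the vertices are the elements of $\mathbb{Z}_n$, and $u,v$ are adjacent iff $v-u\in S$ (the set $S$ satisfies $S=-S$ and $0\notin S$). *)

(* Defs.v *)
From HB Require Import structures.
From mathcomp Require Import all_boot all_order all_algebra.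
Set Implicit Arguments.
Unset Strict Implicit.
Unset Printing Implicit Defensive.
Import GRing.Theory.
Local Open Scope ring_scope.

Definition cayley (G : finZmodType) (S : {set G}) : rel G :=
  fun u v => v - u \in S.

Definition adjmx (F : nzRingType) (n : nat) (e : rel 'I_n) : 'M[F]_n :=
  \matrix_(i < n, j < n) (e i j)%:R.

(* The order of And(k). Since ['Z_m] is the ring of integers mod [maxn m 2],
   ['Z_(andrasfai_order k)] is the intended group exactly when [0 < k]. *)
Definition andrasfai_order (k : nat) : nat := (3 * k - 1)%N.

(* [nat_of_ord x] is the representative of [x] in 0, ..., n - 1. *)
Definition andrasfai_set (k : nat) : {set 'Z_(andrasfai_order k)} :=
  [set x | nat_of_ord x == 1 %[mod 3]].

Definition andrasfai (k : nat) : rel 'Z_(andrasfai_order k) :=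
  cayley (andrasfai_set k).

Lemma card_andrasfai (k : nat) :
  (0 < k)%N -> #|{: 'Z_(andrasfai_order k)}| = (3 * k - 1)%N.
Proof.
move=> k0; rewrite card_ord Zp_cast // /andrasfai_order.
by case: k k0 => // k _; rewrite mulnS.
Qed.

Lemma andrasfai_setN (k : nat) (x : 'Z_(andrasfai_order k)) :
  (0 < k)%N -> (- x \in andrasfai_set k) = (x \in andrasfai_set k).
Proof.
move=> k0; rewrite !inE /=.
have n_gt1 : (1 < andrasfai_order k)%N.
  by rewrite /andrasfai_order; case: k k0 {x} => // k _; rewrite mulnS.
have := ltn_ord x; move: (nat_of_ord x) => y; rewrite (Zp_cast n_gt1) => ltyn.
have [->|y_neq0] := eqVneq y 0%N; first by rewrite subn0 modnn.
rewrite (@modn_small (_ - _)); last first.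
  by rewrite ltn_subrL lt0n y_neq0 (ltnW n_gt1).
have : (andrasfai_order k - y + y + 1 == 0 %[mod 3])%N.
  by rewrite subnK ?(ltnW ltyn) // /andrasfai_order subnK ?muln_gt0 // modnMr.
rewrite -addnA -modnDm -(modnDml y).
move: (andrasfai_order k - y)%N => z.
by case: (y %% 3)%N (ltn_pmod y (isT : 0 < 3)%N) => [|[|[|]]] //;
  case: (z %% 3)%N (ltn_pmod z (isT : 0 < 3)%N) => [|[|[|]]].
Qed.

Lemma andrasfai_set0 (k : nat) : 0 \notin andrasfai_set k.
Proof. by rewrite inE. Qed.

Lemma andrasfai_sym (k : nat) : (0 < k)%N -> symmetric (@andrasfai k).
Proof.
by move=> k0 u v; rewrite /andrasfai /cayley -andrasfai_setN // opprB.
Qed.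

Lemma andrasfai_irr (k : nat) : irreflexive (@andrasfai k).
Proof.
by move=> u; rewrite /andrasfai /cayley subrr (negPf (andrasfai_set0 k)).
Qed.

(* Main.v *)
Require Import Defs.
From mathcomp Require Import all_boot all_order all_algebra.
From mathcomp Require Import zify.
Import GRing.Theory Num.Theory.
Local Open Scope ring_scope.

(** Because S = -S, an eigenvector of And(k) for the eigenvalue 1 is a nonzero
    function f on Z_n, n = 3k - 1, with
      f x = f (x + 1) + f (x + 4) + ... + f (x + 3k - 2)     for all x.
    As S is an arithmetic progression of step 3 and 3k = 1 in Z_n, replacing
    x by x + 3 changes only the two ends of the sum, and subtracting gives
      f (x + 3) - f x = f (x + 2) - f (x + 1).
    So the first difference w x = f (x + 1) - f x satisfies w (x + 2) = - w x
    ([diff_antiperiodic]).  Unless 4 divides n, some odd multiple of 2 vanishes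
    in Z_n, whence w = - w = 0 ([antiperiodic_eq0]); then f is a constant c with
    k c = c, so f = 0 since k > 1 and the characteristic is 0.

    Conversely, if 4 divides n, then Z_n carries a nonzero f with
    f (x + 2) = - f x, namely 1, 0, -1, 0 repeated ([quarter_wave]).  Any four
    consecutive terms of the sum above cancel for such an f, and when k = 3 mod 4
    the three that remain add up to f x ([antiperiodic_sum]).

    Finally 4 divides 3k - 1 exactly when k = 3 mod 4. *)

Lemma andrasfai_order_gt1 (k : nat) : (0 < k)%N -> (1 < andrasfai_order k)%N.
Proof. rewrite /andrasfai_order; lia. Qed.

Lemma Zp_order0 (n : nat) : (1 < n)%N -> n%:R = 0 :> 'Z_n.
Proof. by move=> n1; apply/val_inj; rewrite /= val_Zp_nat // modnn. Qed.

Lemma sum_andrasfai_set (V : nmodType) (k : nat)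
    (f : 'Z_(andrasfai_order k) -> V) : (0 < k)%N ->
  \sum_(x in andrasfai_set k) f x = \sum_(i < k) f (3 * i + 1)%:R.
Proof.
case: k f => // k f _; have n1 := @andrasfai_order_gt1 k.+1 isT.
have lt_n (i : 'I_k.+1) : (3 * i + 1 < andrasfai_order k.+1)%N.
  by rewrite /andrasfai_order; have := ltn_ord i; lia.
rewrite (reindex_onto (fun i : 'I_k.+1 => (3 * i + 1)%:R)
                      (fun x => inord (nat_of_ord x %/ 3))) /=; last first.
  move=> x; rewrite inE => /eqP x1; apply/val_inj => /=.
  have := ltn_ord x; rewrite [X in (_ < X)%N](Zp_cast n1) => ltx.
  have e : (3 * (nat_of_ord x %/ 3) + 1)%N = nat_of_ord x by lia.
  rewrite val_Zp_nat // inordK; first by rewrite e modn_small.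
  by move: ltx; rewrite /andrasfai_order; lia.
apply: eq_bigl => i; rewrite inE val_Zp_nat // (modn_small (lt_n i)).
apply/andP; split; first by apply/eqP; lia.
apply/eqP/val_inj; rewrite /= inordK; last by have := ltn_ord i; lia.
lia.
Qed.

Lemma eigenvalue1_andrasfai (F : fieldType) (k : nat) : (0 < k)%N ->
  eigenvalue (adjmx F (@andrasfai k)) 1 <->
  exists2 f : 'Z_(andrasfai_order k) -> F,
    (forall x, \sum_(i < k) f (x + (3 * i + 1)%:R) = f x) &
    (exists x, f x != 0).
Proof.
move=> k0.
have mulE (v : 'rV[F]_(Zp_trunc (andrasfai_order k)).+2) j :
    (v *m adjmx F (@andrasfai k)) 0 j = \sum_(i < k) v 0 (j + (3 * i + 1)%:R).
  rewrite mxE -(@sum_andrasfai_set _ k (fun s => v 0 (j + s)) k0).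
  rewrite (reindex_inj (addrI j)) [RHS]big_mkcond /=; apply: eq_bigr => s _.
  rewrite mxE andrasfai_sym // /andrasfai /cayley (addrC (j + s)) addKr.
  by case: (s \in _); rewrite (mulr1, mulr0).
split=> [/eigenvalueP [v vA v0] | [f fS [x fx]]].
  exists (v 0) => [x|]; first by rewrite -mulE vA scale1r.
  by have /rV0Pn [x vx] := v0; exists x.
apply/eigenvalueP; exists (\row_x f x).
  apply/rowP => j; rewrite mulE scale1r mxE -[RHS]fS.
  by apply: eq_bigr => i _; rewrite mxE.
by apply/rV0Pn; exists x; rewrite mxE.
Qed.

Lemma antiperiodicM {R : pzRingType} {V : zmodType} (w : R -> V) :
  (forall x, w (x + 2%:R) = - w x) ->
  forall m x, w (x + (2 * m)%:R) = if odd m then - w x else w x.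
Proof.
move=> w2; elim=> [|m IHm] x; first by rewrite muln0 addr0.
rewrite mulnS natrD addrA IHm w2 /=.
by case: (odd m) => //=; rewrite opprK.
Qed.

(** If n is odd then 2n, and if n is 2 mod 4 then n itself, is twice an odd
    number: translating by it is the identity, yet it reverses the sign. *)
Lemma antiperiodic_eq0 (F : numFieldType) (n : nat) (w : 'Z_n -> F) :
  (1 < n)%N -> ~~ (4 %| n)%N -> (forall x, w (x + 2%:R) = - w x) ->
  forall x, w x = 0.
Proof.
move=> n1 n4 w2 x.
have [m m_odd m2] : exists2 m, odd m & (2 * m)%:R = 0 :> 'Z_n.
  have [n_odd|n_even] := boolP (odd n).
    by exists n => //; rewrite natrM Zp_order0 // mulr0.
  exists (n %/ 2)%N; first lia.
  by have -> : (2 * (n %/ 2) = n)%N; [lia | exact: Zp_order0].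
have /eqP := antiperiodicM w w2 m x.
by rewrite m_odd m2 addr0 -addr_eq0 -mulr2n mulrn_eq0 /= => /eqP.
Qed.

(** The terms at x + 1, x + 4, x + 7, x + 10 are f (x + 1), f x, - f (x + 1) and
    - f x, so blocks of four cancel and blocks of three give f x. *)
Lemma antiperiodic_sum (R : pzRingType) (V : zmodType) (f : R -> V) (k : nat) :
  k = 3 %[mod 4] -> (forall x, f (x + 2%:R) = - f x) ->
  forall x, \sum_(i < k) f (x + (3 * i + 1)%:R) = f x.
Proof.
move=> k_mod4 f2.
have fS m j x : f (x + (m + 2 * j)%:R)
    = if odd j then - f (x + m%:R) else f (x + m%:R).
  by rewrite natrD addrA antiperiodicM.
have -> : k = (4 * (k %/ 4) + 3)%N by lia.
elim: (k %/ 4)%N => [|q IHq] x.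
  rewrite !big_ord_recr big_ord0 /= add0r.
  by rewrite (fS 0%N 2%N) (fS 1%N 3%N) /= addr0 addrAC subrr add0r.
have -> : (4 * q.+1 + 3 = (4 * q + 3).+4)%N by lia.
rewrite !big_ord_recr /= IHq; set m := (4 * q + 3)%N.
have -> : (3 * m.+1 + 1 = 3 * m + 2 * 2)%N by lia.
have -> : (3 * m.+2 + 1 = 3 * m + 1 + 2 * 3)%N by lia.
have -> : (3 * m.+3 + 1 = 3 * m + 2 * 5)%N by lia.
by rewrite !fS /= [f x + _ + _]addrAC addrK addrK.
Qed.

(** The real part of the m-th power of the imaginary unit. *)
Definition quarter_wave (R : pzRingType) (m : nat) : R :=
  (m == 0 %[mod 4])%:R - (m == 2 %[mod 4])%:R.

Lemma quarter_waveD2 (R : pzRingType) (m : nat) :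
  quarter_wave R (m + 2) = - quarter_wave R m.
Proof.
rewrite /quarter_wave opprB.
have -> : (m + 2 == 0 %[mod 4]) = (m == 2 %[mod 4]) by lia.
by have -> : (m + 2 == 2 %[mod 4]) = (m == 0 %[mod 4]) by lia.
Qed.

Lemma quarter_wave_mod (R : pzRingType) (n m : nat) :
  (4 %| n)%N -> quarter_wave R (m %% n) = quarter_wave R m.
Proof. by move=> n4; rewrite /quarter_wave !(modn_dvdm _ n4). Qed.

(** The sums at x + 3 and at x share all terms but the last of the former,
    f (x + 3k + 1) = f (x + 2), and the first of the latter, f (x + 1). *)
Lemma diff_antiperiodic (V : zmodType) (k : nat)
    (f : 'Z_(andrasfai_order k) -> V) : (0 < k)%N ->
  (forall x, \sum_(i < k) f (x + (3 * i + 1)%:R) = f x) ->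
  forall x, f (x + 2%:R + 1) - f (x + 2%:R) = - (f (x + 1) - f x).
Proof.
move=> k0 fS x.
have k3 : (3 * k)%:R = 1 :> 'Z_(andrasfai_order k).
  have -> : (3 * k = andrasfai_order k + 1)%N by rewrite /andrasfai_order; lia.
  by rewrite natrD Zp_order0 ?add0r // andrasfai_order_gt1.
have shift : f (x + 1) + f (x + 3%:R) = f x + f (x + 2%:R).
  rewrite -[f (x + 3%:R)]fS -[f x]fS.
  have -> : x + 2%:R = x + (3 * k + 1)%:R by rewrite natrD k3.
  rewrite -(big_ord_recr k (fun i => f (x + (3 * i + 1)%:R))) big_ord_recl /=.
  congr (_ + _); apply: eq_bigr => i _.
  by rewrite -addrA -natrD /bump; congr (f (x + _%:R)); lia.
have -> : x + 2%:R + 1 = x + 3%:R by rewrite -addrA natr1.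
apply/eqP; rewrite opprB subr_eq addrAC eq_sym subr_eq.
by rewrite -shift addrC.
Qed.

Lemma constant_of_diff_eq0 (V : zmodType) (n : nat) (f : 'Z_n -> V) :
  (forall x, f (x + 1) = f x) -> forall x, f x = f 0.
Proof.
move=> f1 x; rewrite -(natr_Zp x).
by elim: (nat_of_ord x) => [//|m IHm]; rewrite -addn1 natrD f1.
Qed.

Theorem lemma3p5 (F : numFieldType) (k : nat) (hk : (2 <= k)%N) :
  eigenvalue (adjmx F (@andrasfai k)) 1 <-> k = 3 %[mod 4].
Proof.
have k0 : (0 < k)%N by lia.
have n1 := andrasfai_order_gt1 k k0.
rewrite eigenvalue1_andrasfai //; split=> [[f fS [x fx]] | k_mod4].
  have [n4|n4] := boolP (4 %| andrasfai_order k)%N.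
    by move: n4; rewrite /andrasfai_order; lia.
  have w0 := antiperiodic_eq0 F _ (fun x => f (x + 1) - f x) n1 n4
               (diff_antiperiodic F k f k0 fS).
  have f_const := constant_of_diff_eq0 F _ f (fun y => subr0_eq (w0 y)).
  have fk : f 0 *+ k = f 0.
    rewrite -[RHS]fS (eq_bigr (fun=> f 0)) ?sumr_const ?card_ord //.
  have : f 0 *+ (k - 1) == 0 by rewrite mulrnBr // fk subrr.
  by rewrite mulrn_eq0 subn_eq0 leqNgt hk -(f_const x) (negPf fx).
have n4 : (4 %| andrasfai_order k)%N by rewrite /andrasfai_order; lia.
have val2 (x : 'Z_(andrasfai_order k)) :
    nat_of_ord (x + 2%:R) = ((x + 2) %% andrasfai_order k)%N.
  by rewrite -[in LHS](natr_Zp x) -natrD val_Zp_nat.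
exists (fun x => quarter_wave F (nat_of_ord x)).
  apply: antiperiodic_sum => // x.
  by rewrite val2 quarter_wave_mod // quarter_waveD2.
by exists 0; rewrite /quarter_wave /= subr0 oner_neq0.
Qed.
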